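(* Let $i,j,k\in\{1,\ldots,N\}$ be pairwise distinct. If $\mathcal P(i,j)=1$ and $\mathcal P(j,k)=1$, then $\mathcal P(i,k)=1$.
   Context: Metric graphs: a metric graph is a connected graph each of whose edges $E$ is identified with an interval $[0,L_E]$ (finite length $L_E>0$) or $[0,\infty)$ (infinite length); directions of edges only serve to fix coordinates. Multiple edges, loops and vertices of degree $1$ are allowed. Each edge $E$ has a constant thickness $\rho_E>0$. At a vertex $V$ with incident edges $E_1,\ldots,E_m$ (a loop is counted twice), $\frac{\partial u}{\partial\nu_k}(V)$ denotes the derivative of $u$ at $V$ along $E_k$ in the direction pointing from $V$ into the interior of $E_k$; the Kirchhoff condition at $V$ is $\sum_{k=1}^m\rho_{E_k}\frac{\partial u}{\partial\nu_k}(V)=0$. The graph $\Omega$: $\Omega=D\cup\Omega_1\cup\cdots\cup\Omega_N$ with $N\ge2$, where $D$ (the center graph) is a bounded finite metric graph (finitely many edges of finite length; possibly a single vertex) and each outer path $\Omega_i$ is an edge of infinite length with $D\cap\Omega_i=\{\mathrm P_i\}$, $\mathrm P_i$ being a vertex of $D$ (the $\mathrm P_i$ are not necessarily distinct). The coordinate on $\Omega_i$ is $x_i\in[0,\infty)$, with $x_i=0$ at $\mathrm P_i$. Nonlinearity: $f\in C^1$ and for some $0<a<1$: $f(0)=f(a)=f(1)=0$, $f<0$ on $(0,a)$, $f>0$ on $(a,1)$, $f'(0)<0$, $f'(a)>0$, $f'(1)<0$, $\int_0^1f(s)\,ds>0$. Solution of $\partial_tu=\Delta_\Omega u+f(u)$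 on a time interval: a function $u(t,x)$ continuous in $(t,x)$ that satisfies $\partial_tu=\partial_x^2u+f(u)$ on each edge except at endpoints, with $\partial_xu$ continuous on each edge up to the endpoints, and the Kirchhoff condition at every vertex. Traveling wave: $(\phi,c)$, $c>0$, is the unique pair with $\phi''+c\phi'+f(\phi)=0$ and $0<\phi<1$ on $\mathbb R$, $\phi(-\infty)=1$, $\phi(+\infty)=0$, $\phi(0)=a$. Front-like solution and limit profile: for each $i$ there is a unique entire solution $\widehat u_i$ (defined for all $t\in\mathbb R$) with $0<\widehat u_i<1$ and $\lim_{t\to-\infty}\big(\sup_{x_i\in\Omega_i}|\widehat u_i|_{\Omega_i}(t,x_i)-\phi(-x_i-ct)|+\sup_{\Omega\setminus\Omega_i}|\widehat u_i(t,\cdot)|\big)=0$; it is strictly increasing in $t$. The limit profile is $\widehat v_i(x)=\lim_{t\to\infty}\widehat u_i(t,x)$. Propagation index: for $i\ne j$, $\lim_{x_j\to\infty}\widehat v_i|_{\Omega_j}(x_j)$ exists and equals $1$ or $0$. If it is $1$, propagation occurs from $\Omega_i$ to $\Omega_j$ and $\mathcal P(i,j)=1$; if it is $0$, blocking occurs and $\mathcal P(i,j)=0$. *)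

(* Defs.v *)
From HB Require Import structures.
From mathcomp Require Import all_boot all_order all_algebra.
From mathcomp Require Import all_classical all_reals all_analysis.

Set Implicit Arguments.
Unset Strict Implicit.
Unset Printing Implicit Defensive.

Import Order.TTheory GRing.Theory Num.Theory.
Import numFieldNormedType.Exports.

Local Open Scope classical_set_scope.
Local Open Scope ring_scope.

Record bistable (R : realType) (f : R -> R) (a : R) : Prop := Bistable {
  bistable_derivable : forall s : R, derivable f s 1;
  bistable_continuous_derive : continuous (derive1 f);
  bistable_a : 0 < a < 1;
  bistable_0 : f 0 = 0;
  bistable_fa : f a = 0;
  bistable_1 : f 1 = 0;
  bistable_neg : forall s : R, 0 < s < a -> f s < 0;
  bistable_pos : forall s : R, a < s < 1 -> 0 < f s;
  bistable_derive0 : derive1 f 0 < 0;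
  bistable_derivea : 0 < derive1 f a;
  bistable_derive1 : derive1 f 1 < 0;
  bistable_integral :
    (0 < \int[lebesgue_measure]_(s in `[0%R, 1%R]%classic) (f s)%:E)%E }.

Record traveling_wave (R : realType) (f : R -> R) (a : R)
    (phi : R -> R) (c : R) : Prop := TravelingWave {
  wave_speed_gt0 : 0 < c;
  wave_derivable : forall z : R, derivable phi z 1;
  wave_derivable2 : forall z : R, derivable (derive1 phi) z 1;
  wave_eq : forall z,
    derive1 (derive1 phi) z + c * derive1 phi z + f (phi z) = 0;
  wave_bounds : forall z, 0 < phi z < 1;
  wave_ninfty : phi z @[z --> -oo] --> (1 : R);
  wave_pinfty : phi z @[z --> +oo] --> (0 : R);
  wave_normalized : phi 0 = a }.

(* The graph Omega = D \cup Omega_1 \cup ... \cup Omega_N.  All vertices lie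
   in D.  [inl d] is the edge d of D, identified with [0, len d]; [inr i] is
   the outer path Omega_i, identified with [0, +oo[, whose coordinate 0 is the
   vertex [root i] (the point P_i).  Loops, multiple edges, non-distinct
   P_i, and D reduced to a single vertex are all allowed. *)
Record outer_path_graph (R : realType) (N : nat) := OuterPathGraph {
  vertex : finType;
  center_edge : finType;
  src : center_edge -> vertex;
  tgt : center_edge -> vertex;
  len : center_edge -> R;
  len_gt0 : forall d, 0 < len d;
  center_connected : forall v w : vertex,
    connect [rel x y | [exists d, ((src d == x) && (tgt d == y))
                               || ((src d == y) && (tgt d == x))]] v w;
  root : 'I_N -> vertex;
  thickness : center_edge + 'I_N -> R;
  thickness_gt0 : forall e, 0 < thickness e }.

Section Graph.
Context {R : realType} {N : nat} (G : outer_path_graph R N).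

Definition edge : Type := (center_edge G + 'I_N)%type.

Definition edge_dom (e : edge) : set R :=
  match e with inl d => `[0, len d] | inr _ => `[0, +oo[ end.

Definition edge_inner (e : edge) : set R :=
  match e with inl d => `]0, len d[ | inr _ => `]0, +oo[ end.

(* The ends of edges: [inl (d, false)] is the end x = 0 of d, [inl (d, true)]
   the end x = len d, [inr i] the end x_i = 0 of Omega_i.  The ends h with
   [end_vertex h = v] enumerate the edges incident to v, loops twice. *)
Definition edge_end : Type := (center_edge G * bool + 'I_N)%type.

Definition end_vertex (h : edge_end) : vertex G :=
  match h with
  | inl (d, false) => src d | inl (d, true) => tgt d | inr i => root G i
  end.

Definition end_edge (h : edge_end) : edge :=
  match h with inl (d, _) => inl d | inr i => inr i end.

Definition end_coord (h : edge_end) : R :=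
  match h with inl (d, true) => len d | _ => 0 end.

(* A function on Omega is given by its coordinate expressions
   [w : edge -> R -> R]; only the values [w e x] with x in [edge_dom e] are
   meaningful, and they must agree at the vertices. *)
Definition well_defined (w : edge -> R -> R) : Prop :=
  forall h h' : edge_end, end_vertex h = end_vertex h' ->
    w (end_edge h) (end_coord h) = w (end_edge h') (end_coord h').

(* Derivative at x relative to A; one-sided at an endpoint of an interval. *)
Definition has_derive_in (A : set R) (g : R -> R) (x l : R) : Prop :=
  (g y - g x) / (y - x) @[y --> within A (x^')] --> l.

(* With p the coordinate derivative of w, the derivative at the end h in the
   direction pointing into the edge. *)
Definition inward_derive (p : edge -> R -> R) (h : edge_end) : R :=
  match h with
  | inl (_, true) => - p (end_edge h) (end_coord h)
  | _ => p (end_edge h) (end_coord h)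
  end.

Definition kirchhoff (p : edge -> R -> R) (v : vertex G) : Prop :=
  \sum_(h : center_edge G * bool + 'I_N | end_vertex h == v)
    thickness (end_edge h) * inward_derive p h = 0.

(* [u t e x]: value at time t at the point of coordinate x of the edge e;
   [p] is the x-derivative of u. *)
Record entire_solution (f : R -> R) (u : R -> edge -> R -> R) : Prop :=
  EntireSolution {
  sol_well_defined : forall t, well_defined (u t);
  sol_continuous : forall e,
    {within [set tx : R * R | edge_dom e tx.2],
      continuous (fun tx : R * R => u tx.1 e tx.2)};
  sol_eq : exists p : R -> edge -> R -> R,
    [/\ forall t e x, edge_dom e x ->
          has_derive_in (edge_dom e) (u t e) x (p t e x),
        forall t e, {within edge_dom e, continuous (p t e)},
        forall (t : R) e x, edge_inner e x ->
          [/\ derivable (fun s : R => u s e x) t 1,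
              derivable (p t e) x 1
            & derive1 (fun s => u s e x) t = derive1 (p t e) x + f (u t e x)]
      & forall t v, kirchhoff (p t) v] }.

(* The point of coordinate x on e belongs to Omega_i; for [e <> inr i] this
   means that it is the vertex P_i. *)
Definition on_outer_path (i : 'I_N) (e : edge) (x : R) : Prop :=
  e = inr i \/
  exists h, [/\ end_edge h = e, end_coord h = x & end_vertex h = root G i].

Definition front_distance (phi : R -> R) (c : R) (i : 'I_N)
    (u : R -> edge -> R -> R) (t : R) : \bar R :=
  (ereal_sup [set y | exists2 x, edge_dom (inr i) x &
                y = `|u t (inr i) x - phi (- x - c * t)|%:E]
   + ereal_sup [set y | exists e x,
                [/\ edge_dom e x, ~ on_outer_path i e x & y = `|u t e x|%:E]]
  )%E.

Record front_like (f phi : R -> R) (c : R) (i : 'I_N)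
    (u : R -> edge -> R -> R) : Prop := FrontLike {
  front_solution : entire_solution f u;
  front_bounds : forall t e x, edge_dom e x -> 0 < u t e x < 1;
  front_ninfty : front_distance phi c i u t @[t --> -oo] --> 0%:E }.

Definition limit_profile (u : R -> edge -> R -> R) (v : edge -> R -> R) :
    Prop :=
  forall e x, edge_dom e x -> u t e x @[t --> +oo] --> v e x.

(* The front-like solution for i exists and is unique on Omega, and its limit
   profile has limit 0 or 1 along Omega_j; so "exists u" speaks about that
   solution, and [propagation_index] is 0 exactly in the case of blocking. *)
Definition propagates (f phi : R -> R) (c : R) (i j : 'I_N) : Prop :=
  exists u v, [/\ front_like f phi c i u, limit_profile u v
                & v (inr j) x @[x --> +oo] --> (1 : R)].

Definition propagation_index (f phi : R -> R) (c : R) (i j : 'I_N) : nat :=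
  `[< propagates f phi c i j >].

End Graph.

(* Main.v *)
Require Import Defs.
From mathcomp Require Import all_boot all_order all_algebra.
From mathcomp Require Import all_classical all_reals all_analysis.
From mathcomp Require Import lra ring.

Set Implicit Arguments.
Unset Strict Implicit.
Unset Printing Implicit Defensive.

Import Order.TTheory GRing.Theory Num.Theory.
Import numFieldNormedType.Exports.

Local Open Scope classical_set_scope.
Local Open Scope ring_scope.

(** Let [ui], [uj] be the front-like solutions entering from Omega_i and Omega_j,
    and [vi], [vj] their limit profiles.  The theorem follows from [uj <= vi]
    everywhere and for all times: letting t tend to +oo gives [vj <= vi <= 1],
    and [vj] tends to 1 along Omega_k.

    Why [uj <= vi].  As t tends to -oo, [uj] is small except far out on
    Omega_j, which is where [vi] is close to 1.  So at very negative times, at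
    each point where [uj] exceeds [vi], either both values are close to 0 or both
    are close to 1.  There [f] is decreasing at a definite rate b, and hence the
    maximal excess decays like exp(- b t) as long as t stays below some time T0.
    The excess never exceeds 1, so going back to -oo for the starting time shows
    that it vanishes at T0; after T0 it grows at most like exp(K t), with K a
    Lipschitz constant of [f], and stays zero.

    To avoid parabolic regularity theory, which would be needed to see that
    [vi] is itself a solution, [uj] is compared with the shifts [ui (t + s)] for
    s large.  At fixed s there is no lower bound on this shift at infinity on
    Omega_j: it is close to 1 on a long bounded piece of Omega_j, and the rest is
    absorbed by delta times a quadratic function [barrier] tending to infinity
    along the outer paths ([comparison], [front_le_limit]).  The lower bound on
    that piece must be uniform, while [ui] converges to [vi] only pointwise: on a
    short interval, a solution whose boundary values stay above l is, two time
    units later, above l up to an error controlled by the length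
    ([ge_between], [eventually_ge_on_segment]).

    Both steps rest on the maximum principle in its most elementary form: at
    a positive maximum inside an edge the time derivative is nonnegative and the
    second space derivative nonpositive, and at a vertex all inward derivatives
    are nonpositive, which contradicts the Kirchhoff condition because the inward
    derivatives of [barrier] are negative. *)

(** * One-variable calculus *)

Section OneVariable.
Context {R : realType}.
Implicit Types (g q : R -> R) (A : set R) (x l : R).

Lemma has_derive_inP A g x l :
  has_derive_in A g x l <->
  forall e : R, 0 < e -> exists2 r : R, 0 < r & forall y, A y -> y != x ->
    `|x - y| < r -> `|l - (g y - g x) / (y - x)| < e.
Proof.
rewrite /has_derive_in; split => [/cvgrPdist_lt gl e e0|H].
  have /= [r /= r0 Hr] := gl e e0.
  by exists r => // y Ay yx yr; exact: Hr.
apply/cvgrPdist_lt => e e0; have [r r0 Hr] := H _ e0.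
by exists r => //= y /= yr yx Ay; exact: Hr.
Qed.

Lemma is_deriveP g x l : is_derive x 1 g l <-> has_derive_in setT g x l.
Proof.
have quot h : h != 0 -> h^-1 *: (g (h *: 1 + x) - g x) =
    (g (x + h) - g x) / (x + h - x).
  by move=> h0; rewrite [h *: 1]mulr1 (addrC h) [x + h - x]addrC addKr mulrC.
rewrite has_derive_inP; split => [[dg gl] e e0|H].
  have : h^-1 *: ((g \o shift x) (h *: 1) - g x) @[h --> 0^'] --> l.
    by rewrite -gl; exact: dg.
  move=> /cvgrPdist_lt/(_ e e0)[r /= r0 Hr].
  exists r => // y _ yx yr; have yx0 : y - x != 0 by rewrite subr_eq0.
  have := Hr (y - x); rewrite /= quot// sub0r normrN (distrC y).
  by rewrite [x + (y - x)]addrC subrK; exact.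
have gl : h^-1 *: ((g \o shift x) (h *: 1) - g x) @[h --> 0^'] --> l.
  apply/cvgrPdist_lt => e e0; have [r r0 Hr] := H _ e0.
  exists r => //= h /=; rewrite sub0r normrN => hr h0.
  rewrite quot//; apply: Hr => //.
    by rewrite -subr_eq0 addrC addKr.
  by rewrite opprD addrA subrr sub0r normrN.
by apply: DeriveDef; [apply/cvg_ex; exists l|exact: cvg_lim gl].
Qed.

Lemma is_derive1_derivable g x : derivable g x 1 -> is_derive x 1 g (derive1 g x).
Proof. by move=> dg; rewrite derive1E; exact: derivableP. Qed.

Lemma has_derive_in_interior A g x l : nbhs x A ->
  has_derive_in A g x l -> is_derive x 1 g l.
Proof.
move=> -[r /= r0 rA] /has_derive_inP H; apply/is_deriveP/has_derive_inP => e e0.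
have [s s0 Hs] := H _ e0; exists (Num.min r s); first by rewrite lt_min r0.
by move=> y _ yx; rewrite lt_min => /andP[yr ys]; apply: Hs => //; exact: rA.
Qed.

Lemma has_derive_inW A B g x l : A `<=` B ->
  has_derive_in B g x l -> has_derive_in A g x l.
Proof.
move=> AB /has_derive_inP H; apply/has_derive_inP => e /H[r r0 Hr].
by exists r => // y /AB; exact: Hr.
Qed.

(** Only the side of the maximum point on which A lies matters, which is what is
    needed at the ends of edges and at the last instant of a time interval. *)
Lemma has_derive_in_max_le0 A g x l b : x < b ->
  `]x, b[ `<=` A -> (forall y, A y -> g y <= g x) ->
  has_derive_in A g x l -> l <= 0.
Proof.
move=> xb bA gx /has_derive_inP H; rewrite leNgt; apply/negP => l0.
have [r r0 Hr] := H _ l0.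
pose s := Num.min r (b - x) / 2.
have [s0 sr sb] : [/\ 0 < s, s < r & s < b - x].
  have m0 : 0 < Num.min r (b - x) by rewrite lt_min r0 subr_gt0.
  have sm : s < Num.min r (b - x) by rewrite /s; lra.
  move: sm; rewrite lt_min => /andP[? ?]; split => //.
  by rewrite /s divr_gt0.
have Axs : A (x + s) by apply: bA; rewrite /= in_itv/=; lra.
have := Hr (x + s) Axs; rewrite opprD addrA subrr sub0r normrN gtr0_norm//.
rewrite -subr_eq0 [x + s - x]addrC addKr => /(_ (lt0r_neq0 s0) sr).
apply/negP; rewrite -leNgt (le_trans _ (ler_norm _))// lerBrDr gerDl.
by rewrite pmulr_lle0 ?invr_gt0// subr_le0 gx.
Qed.

Lemma has_derive_inN A g x l : has_derive_in A g x l ->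
  has_derive_in [set y | A (- y)] (g \o -%R) (- x) (- l).
Proof.
move=> /has_derive_inP H; apply/has_derive_inP => e /H[r r0 Hr].
exists r => // y Ay yx xy.
rewrite /= -normrN opprD !opprK -[y + x]opprK invrN mulrN opprD.
have yx' : - y != x by rewrite eqr_oppLR.
have xy' : `|x - - y| < r by rewrite -normrN opprB addrC.
exact: Hr _ Ay yx' xy'.
Qed.

Lemma has_derive_in_max_ge0 A g x l b : b < x ->
  `]b, x[ `<=` A -> (forall y, A y -> g y <= g x) ->
  has_derive_in A g x l -> 0 <= l.
Proof.
move=> bx bA gx /has_derive_inN; rewrite -oppr_le0.
apply: (@has_derive_in_max_le0 _ _ _ _ (- b)); first by rewrite ltrN2.
  by move=> y /=; rewrite in_itv/= => yb; apply: bA; rewrite /= in_itv/=; lra.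
by move=> y /= /gx; rewrite opprK.
Qed.

Lemma max_derive_ge0 g x l b : b < x -> (forall y, b <= y <= x -> g y <= g x) ->
  is_derive x 1 g l -> 0 <= l.
Proof.
move=> bx gx /is_deriveP/(@has_derive_inW `]b, x[ setT _ _ _ (@subsetT _ _)).
apply: (has_derive_in_max_ge0 bx) => // y /=; rewrite in_itv/= => /andP[? ?].
by apply: gx; rewrite !ltW.
Qed.

(** If the second derivative were positive, the first derivative, which
    vanishes at x, would be positive just after x. *)
Lemma max_derive2_le0 g q x l b1 b2 : b1 < x < b2 ->
  (forall y, b1 < y < b2 -> is_derive y 1 g (q y)) ->
  (forall y, b1 < y < b2 -> g y <= g x) ->
  is_derive x 1 q l -> l <= 0.
Proof.
move=> /andP[b1x xb2] gq gx /is_deriveP/has_derive_inP ql.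
have q0 : q x = 0.
  have /is_deriveP/(@has_derive_inW `]b1, b2[ setT _ _ _ (@subsetT _ _)) Dx :
    is_derive x 1 g (q x) by apply: gq; rewrite b1x.
  have gx' y : `]b1, b2[%classic y -> g y <= g x by rewrite /= in_itv; exact: gx.
  apply/eqP; rewrite eq_le; apply/andP; split.
    apply: (has_derive_in_max_le0 xb2 _ gx' Dx) => y /=.
    by rewrite !in_itv/=; lra.
  apply: (has_derive_in_max_ge0 b1x _ gx' Dx) => y /=.
  by rewrite !in_itv/=; lra.
rewrite leNgt; apply/negP => l0; have [r r0 Hr] := ql _ l0.
pose s := Num.min r (b2 - x) / 2.
have [s0 sr sb] : [/\ 0 < s, s < r & s < b2 - x].
  have m0 : 0 < Num.min r (b2 - x) by rewrite lt_min r0 subr_gt0.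
  have sm : s < Num.min r (b2 - x) by rewrite /s; lra.
  move: sm; rewrite lt_min => /andP[? ?]; split => //.
  by rewrite /s divr_gt0.
have qpos y : x < y <= x + s -> 0 < q y.
  move=> /andP[xy yxs]; have := Hr y I.
  rewrite q0 subr0 gt_eqF// distrC gtr0_norm ?subr_gt0//.
  move=> /(_ isT) H; have /H : y - x < r by lra.
  rewrite ltr_norml => /andP[_]; rewrite ltrBlDr ltrDl pmulr_lgt0//.
  by rewrite invr_gt0 subr_gt0.
have [|y||c] := @MVT _ g q x (x + s); first by lra.
- by rewrite in_itv/= => yxs; apply: gq; lra.
- apply: derivable_within_continuous => y; rewrite in_itv/= => yxs.
  by have [] : is_derive y 1 g (q y) by apply: gq; lra.
rewrite in_itv/= => cxs E.
have : 0 < q c * (x + s - x) by rewrite mulr_gt0//; [apply: qpos|]; lra.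
by rewrite -E subr_gt0 ltNge gx//; lra.
Qed.

Lemma has_derive_in_lin A g k x l l' (a b : R) :
  has_derive_in A g x l -> has_derive_in A k x l' ->
  has_derive_in A (fun y => a * g y + b * k y) x (a * l + b * l').
Proof.
move=> gl kl.
have C : (a * ((g y - g x) / (y - x)) + b * ((k y - k x) / (y - x)))
    @[y --> within A x^'] --> a * l + b * l'.
  by apply: cvgD; exact: cvgMl_tmp.
move: C; rewrite /has_derive_in; apply: cvg_trans; apply: near_eq_cvg; near=> y => /=.
by rewrite !mulrA -mulrDl; congr (_ / _); ring.
Unshelve. all: by end_near. Qed.

Lemma is_derive_quadratic (a b c : R) x :
  is_derive x 1 (fun y : R => a * y ^+ 2 + b * y + c) (2 * a * x + b).
Proof.
apply/is_deriveP/has_derive_inP => e e0; have a1 : 0 < `|a| + 1 by rewrite ltr_wpDl.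
exists (e / (`|a| + 1)) => [|y _ yx]; first by rewrite divr_gt0.
rewrite ltr_pdivlMr// => yr.
have yx0 : y - x != 0 by rewrite subr_eq0.
rewrite [X in `|X|](_ : _ = a * (x - y)); last by field.
rewrite normrM mulrC; apply: le_lt_trans yr.
by rewrite ler_wpM2l// lerDl.
Qed.

Lemma is_derive_expR_linear (k T t : R) :
  is_derive t 1 (fun s => expR (k * (s - T))) (expR (k * (t - T)) * k).
Proof.
apply: (@is_derive1_comp _ expR (fun s => k * (s - T))).
rewrite [X in is_derive _ _ X _](_ : _ =
    fun s => 0 * s ^+ 2 + k * s + - (k * T)); last by apply/funext => s; ring.
by apply: is_derive_eq (is_derive_quadratic _ _ _ _) _; ring.
Qed.

Lemma decreasing_near (f : R -> R) (z : R) : (forall s : R, derivable f s 1) ->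
  continuous (derive1 f) -> derive1 f z < 0 ->
  exists b e, [/\ 0 < b, 0 < e & forall s r, z - e <= s -> s <= r -> r <= z + e ->
    f r - f s <= - b * (r - s)].
Proof.
move=> df cf fz; have b0 : 0 < - derive1 f z / 2 by lra.
have [e /= e0 eP] : \forall y \near z, derive1 f y < derive1 f z / 2.
  by apply: (cvgr_lt (derive1 f z) (cf z)); lra.
exists (- derive1 f z / 2), (e / 2); split => // [|s r zs sr rz].
  by rewrite divr_gt0.
have [y _||y] := @MVT_segment _ f (derive1 f) s r sr.
- exact: is_derive1_derivable.
- exact: derivable_within_continuous.
rewrite in_itv/= => /andP[sy yr] ->; apply: ler_wpM2r; first by rewrite subr_ge0.
rewrite -mulNr opprK ltW//; apply: eP; rewrite /= ltr_norml; lra.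
Qed.

Lemma lipschitz_on01 (f : R -> R) : (forall s : R, derivable f s 1) ->
  continuous (derive1 f) ->
  exists2 K, 0 <= K & forall s r, 0 <= s -> s <= r -> r <= 1 ->
    f r - f s <= K * (r - s).
Proof.
move=> df cf.
have [y _ ymax] := EVT_max (@ler01 R) (continuous_subspaceT cf).
exists (Num.max 0 (derive1 f y)) => [|s r s0 sr r1]; first by rewrite le_max lexx.
have [z _||z] := @MVT_segment _ f (derive1 f) s r sr.
- exact: is_derive1_derivable.
- exact: derivable_within_continuous.
rewrite in_itv/= => /andP[sz zr] ->; apply: ler_wpM2r; first by rewrite subr_ge0.
by rewrite le_max ymax ?orbT// in_itv/=; lra.
Qed.

(** For two ordered values that are both near 0, or both near 1, the reaction
    term brings them closer at a fixed exponential rate. *)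
Lemma bistable_dissipative (f : R -> R) (a : R) : bistable f a ->
  exists b eps, [/\ 0 < b, 0 < eps, eps <= 1 &
    forall s r, 0 < s -> s <= r -> r < 1 -> r <= eps \/ 1 - eps <= s ->
      f r - f s <= - b * (r - s)].
Proof.
move=> bf.
have [df cf] := (bistable_derivable bf, bistable_continuous_derive bf).
have [b0 [z0 [b00 z00 f0]]] := decreasing_near df cf (bistable_derive0 bf).
have [b1 [z1 [b10 z10 f1]]] := decreasing_near df cf (bistable_derive1 bf).
have [eps [eps0 eps1 epsz0 epsz1]] :
    exists eps, [/\ 0 < eps, eps <= 1, eps <= z0 & eps <= z1].
  exists (Num.min 1 (Num.min z0 z1)).
  by rewrite !lt_min !ge_min !lexx !orbT ltr01 z00.
have [b [bgt0 bb0 bb1]] : exists b, [/\ 0 < b, b <= b0 & b <= b1].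
  by exists (Num.min b0 b1); rewrite lt_min !ge_min !lexx !orbT b00.
exists b, eps; split => // s r s0 sr r1 [re|se].
  apply: (@le_trans _ _ (- b0 * (r - s))); first by apply: f0; lra.
  by rewrite ler_wpM2r ?subr_ge0// lerN2.
apply: (@le_trans _ _ (- b1 * (r - s))); first by apply: f1; lra.
by rewrite ler_wpM2r ?subr_ge0// lerN2.
Qed.

End OneVariable.

Arguments has_derive_in_lin {R A g k x l l'} a b _ _.

(** * Edges, time shifts and maxima on the graph *)

Section OuterPathGraph.
Context {R : realType} {N : nat} {G : outer_path_graph R N}.
Implicit Types (e : edge G) (h : edge_end G) (f : R -> R).

Lemma edge_dom_cases e x : edge_dom e x ->
  edge_inner e x \/ exists h, end_edge h = e /\ end_coord h = x.
Proof.
case: e => [d|i]; rewrite /= !in_itv/= ?andbT.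
  move=> /andP[]; rewrite le_eqVlt => /orP[/eqP <- _|x0].
    by right; exists (inl (d, false)).
  rewrite le_eqVlt => /orP[/eqP ->|xl]; first by right; exists (inl (d, true)).
  by left; rewrite x0.
rewrite le_eqVlt => /orP[/eqP <-|]; first by right; exists (inr i).
by left.
Qed.

Lemma edge_dom_end h : edge_dom (end_edge h) (end_coord h).
Proof. by case: h => [[d []]|i]; rewrite /= in_itv/= ?lexx ?ltW ?len_gt0. Qed.

Lemma edge_inner_dom e x : edge_inner e x -> edge_dom e x.
Proof.
case: e => [d|i]; rewrite /= !in_itv/= ?andbT; last exact: ltW.
by move=> /andP[? ?]; rewrite !ltW.
Qed.

Lemma edge_inner_nbhs e x : edge_inner e x ->
  exists b, b.1 < x < b.2 /\ forall y, b.1 < y < b.2 -> edge_inner e y.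
Proof.
case: e => [d|i]; rewrite /= in_itv/= ?andbT => xd.
  by exists (0, len d); split => //= y; rewrite in_itv.
exists (0, x + 1); split => /=; first by rewrite xd ltrDl ltr01.
by move=> y /andP[y0 _]; rewrite in_itv/= y0.
Qed.

(** Outside the compact part of the graph cut off at coordinate B the values are
    at most m, so the maximum over that compact part is global once it exceeds
    m. *)
Lemma graph_max (F : R -> edge G -> R -> R) (T t1 m B : R) :
  (forall e, {within [set tx : R * R | edge_dom e tx.2],
     continuous (fun tx : R * R => F tx.1 e tx.2)}) ->
  (forall t (i : 'I_N) x, T <= t <= t1 -> B <= x -> F t (inr i) x <= m) ->
  (exists t e x, [/\ T <= t <= t1, edge_dom e x & m < F t e x]) ->
  exists t e x, [/\ T <= t <= t1, edge_dom e x, m < F t e x &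
    forall s e' y, T <= s <= t1 -> edge_dom e' y -> F s e' y <= F t e x].
Proof.
move=> Fc Fm [t0 [e0 [x0 [t0T x0d mF0]]]].
pose C := Num.max B 0.
pose r e := match e with inl d => len d | inr _ => C end.
have r0 e : 0 <= r e.
  by case: e => [d|i] /=; [rewrite ltW ?len_gt0|rewrite le_max lexx orbT].
pose K e : set (R * R) := `[T, t1]%classic `*` `[0, r e]%classic.
have KE e tx : K e tx <-> T <= tx.1 <= t1 /\ 0 <= tx.2 <= r e.
  by rewrite /K /= !in_itv.
have Kdom e tx : K e tx -> edge_dom e tx.2.
  by move=> /KE[_]; case: e => [d|i]; rewrite /= in_itv//= andbT => /andP[].
have Kc e : compact (K e) by apply: compact_setX; exact: segment_compact.
have K0 e : K e !=set0.
  by exists (t0, 0); apply/KE; split; rewrite //= lexx r0.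
have FK e : {within K e, continuous (fun tx : R * R => F tx.1 e tx.2)}.
  by apply: continuous_subspaceW (Fc e) => tx; exact: Kdom.
have /choice[p pmax] e : exists p, K e p /\
    forall q, K e q -> F q.1 e q.2 <= F p.1 e p.2.
  have [p pK pmax] := compact_EVT_max (K0 e) (Kc e) (FK e).
  by exists p; split => [|q qK]; [exact: set_mem|apply: pmax; exact: mem_set].
pose M (e : (center_edge G + 'I_N)%type) := F (p e).1 e (p e).2.
case: (Order.TotalTheory.arg_maxP M (erefl : predT e0)) => e _ emax.
have Mmax s e' y : T <= s <= t1 -> edge_dom e' y ->
    F s e' y <= m \/ F s e' y <= M e.
  move=> sT yd; have [yr|] := leP y (r e'); last first.
    case: e' yd => [d|i] /=; rewrite in_itv/=; first by lra.
    move=> _ Cy; left; apply: Fm => //.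
    by rewrite ltW// (le_lt_trans _ Cy)// le_max lexx.
  right; apply: le_trans (emax e' isT); apply: (pmax e').2 (s, y) _.
  apply/KE; split => //=; rewrite yr andbT.
  by case: e' yd {yr} => [d|i] /=; rewrite in_itv/= => /andP[].
have mM : m < M e.
  by have [|] := Mmax _ _ _ t0T x0d; [rewrite leNgt mF0|exact: lt_le_trans].
exists (p e).1, e, (p e).2; split => //.
- by have /KE[] := (pmax e).1.
- exact: Kdom (pmax e).1.
- move=> s e' y sT yd; have [/le_lt_trans/(_ mM)/ltW|] // := Mmax _ _ _ sT yd.
Qed.

Lemma entire_solution_shift f (u : R -> edge G -> R -> R) s :
  entire_solution f u -> entire_solution f (fun t => u (t + s)).
Proof.
case=> wd uc [p [pd pc peq pk]]; split; first by move=> t; exact: wd.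
- move=> e; apply/subspace_continuousP => tx xd.
  have /subspace_continuousP/(_ (tx.1 + s, tx.2) xd) := uc e.
  have c : (y.1 + s, y.2) @[y --> tx] --> (tx.1 + s, tx.2).
    apply: (@cvg_pair _ _ _ (nbhs tx) (nbhs (tx.1 + s)) (nbhs tx.2)) => /=;
      last exact: cvg_snd.
    apply: cvgD; last exact: cvg_cst.
    exact: (@cvg_fst _ _ (nbhs tx.1) (nbhs tx.2)).
  by move=> H U /H K; exact: c _ K.
exists (fun t => p (t + s)); split => [t|t|t e x xe|t].
- exact: pd.
- exact: pc.
- have [d1 d2 E] := peq (t + s) e x xe.
  have D : is_derive t 1 (fun r => u (r + s) e x) (derive1 (fun r => u r e x) (t + s)).
    rewrite -[X in is_derive _ _ _ X]mulr1.
    apply: (@is_derive1_comp _ (fun r => u r e x) (shift s)).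
      exact: (is_derive1_derivable d1).
    exact: is_derive_shift.
  case: D => D1 D2; split; [exact: D1|exact: d2|by rewrite -E derive1E D2].
- exact: pk.
Qed.

(** * Comparison of two solutions *)

(** Minus the slope of [barrier] at the beginning of the edge. *)
Definition edge_slope e : R := match e with inl d => len d | inr _ => 1 end.

(** It takes the same value at all vertices, is nonnegative, has second derivative
    2, has a negative derivative in the direction pointing into the edge at every
    end, and tends to infinity along the outer paths.  The sum of squares
    compensates for x ^ 2 - len * x on the edges of the center graph. *)
Definition barrier e (x : R) : R :=
  1 + \sum_(d : center_edge G) len d ^+ 2 + x ^+ 2 - edge_slope e * x.

Lemma edge_slope_gt0 e : 0 < edge_slope e.
Proof. by case: e => [d|i] /=; rewrite ?len_gt0 ?ltr01. Qed.

Lemma barrier_ge0 e x : edge_dom e x -> 0 <= barrier e x.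
Proof.
have S0 : 0 <= \sum_(d : center_edge G) len d ^+ 2.
  by apply: sumr_ge0 => d _; exact: sqr_ge0.
rewrite /barrier; case: e => [d|i] /=; rewrite in_itv/=; last by nra.
move=> /andP[x0 xl].
have : len d ^+ 2 <= \sum_(d : center_edge G) len d ^+ 2.
  by rewrite (bigD1 d)//= lerDl; apply: sumr_ge0 => ? _; exact: sqr_ge0.
nra.
Qed.

Lemma barrier_outer_ge (i : 'I_N) (x : R) : x <= barrier (inr i) x.
Proof.
have S0 : 0 <= \sum_(d : center_edge G) len d ^+ 2.
  by apply: sumr_ge0 => d _; exact: sqr_ge0.
by have := sqr_ge0 (x - 1); rewrite /barrier /=; lra.
Qed.

Lemma barrier_end h :
  barrier (end_edge h) (end_coord h) = 1 + \sum_(d : center_edge G) len d ^+ 2.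
Proof. by case: h => [[d []]|i]; rewrite /barrier /=; ring. Qed.

Lemma inward_derive_barrier h :
  inward_derive (fun e x => 2 * x - edge_slope e) h = - edge_slope (end_edge h).
Proof. by case: h => [[d []]|i] /=; ring. Qed.

Lemma inward_derive_max_le0 (F p : edge G -> R -> R) h :
  (forall x, edge_dom (end_edge h) x ->
     F (end_edge h) x <= F (end_edge h) (end_coord h)) ->
  has_derive_in (edge_dom (end_edge h)) (F (end_edge h)) (end_coord h)
    (p (end_edge h) (end_coord h)) ->
  inward_derive p h <= 0.
Proof.
case: h => [[d []]|i] /= Fmax Fp; first last.
- apply: has_derive_in_max_le0 Fmax Fp; first exact: ltr01.
  by move=> y /=; rewrite !in_itv/=; lra.
- apply: has_derive_in_max_le0 Fmax Fp; first exact: (len_gt0 d).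
  by move=> y /=; rewrite !in_itv/=; lra.
- rewrite oppr_le0; apply: has_derive_in_max_ge0 Fmax Fp; first exact: (len_gt0 d).
  by move=> y /=; rewrite !in_itv/=; lra.
Qed.

Lemma inward_derive_lin (p q : edge G -> R -> R) (a b : R) h :
  inward_derive (fun e x => a * p e x + b * q e x) h =
  a * inward_derive p h + b * inward_derive q h.
Proof. by case: h => [[d []]|i] /=; ring. Qed.

(** Where [u] exceeds [w] noticeably, the reaction term makes the difference
    grow at rate at most k, so exp(- k (t - T)) * (u - w) is a subsolution of the
    heat equation there.  It cannot reach m + delta (barrier + 3 (t - T)) from
    below: inside the edges this function has time derivative 3 delta and second
    space derivative 2 delta, and at the vertices its inward derivatives are
    negative.  With k negative this gives decay, with k positive a Gronwall
    estimate. *)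
Lemma comparison f (u w : R -> edge G -> R -> R) (k delta m T t1 : R) :
  entire_solution f u -> entire_solution f w ->
  (forall t e x, edge_dom e x -> u t e x - w t e x <= 1) ->
  0 < delta -> 0 <= m ->
  (forall e x, edge_dom e x -> u T e x - w T e x <= m + delta * barrier e x) ->
  (forall t e x, T <= t <= t1 -> edge_inner e x ->
    delta * barrier e x * expR (k * (t - T)) < u t e x - w t e x ->
    f (u t e x) - f (w t e x) <= k * (u t e x - w t e x)) ->
  forall t e x, T <= t <= t1 -> edge_dom e x ->
    u t e x - w t e x <=
      expR (k * (t - T)) * (m + delta * (barrier e x + 3 * (t - T))).
Proof.
move=> [uwd uc [pu [pud _ pueq puk]]] [wwd wc [pw [pwd _ pweq pwk]]].
move=> uw1 d0 m0 uwT uwf t0 e0 x0 t0T x0d.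
pose E t := expR (- k * (t - T)).
have E0 t : 0 < E t by exact: expR_gt0.
have EN t : expR (k * (t - T)) * E t = 1.
  by rewrite -expRD mulNr subrr expR0.
pose Z t e x := E t * (u t e x - w t e x) - delta * (barrier e x + 3 * (t - T)).
suff Zm : Z t0 e0 x0 <= m.
  have : E t0 * (u t0 e0 x0 - w t0 e0 x0) <=
      m + delta * (barrier e0 x0 + 3 * (t0 - T)) by rewrite -lerBlDr.
  by rewrite -(ler_pM2l (expR_gt0 (k * (t0 - T)))) mulrA EN mul1r.
rewrite leNgt; apply/negP => Zm.
(* Beyond B the term delta * barrier exceeds the largest possible value of the
   rescaled difference. *)
pose B := expR (`|k| * (t1 - T)) / delta.
have Zc e : {within [set tx : R * R | edge_dom e tx.2],
    continuous (fun tx : R * R => Z tx.1 e tx.2)}.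
  have pc (g : R * R -> R) : continuous g ->
    {within [set tx : R * R | edge_dom e tx.2], continuous g}.
    exact: continuous_subspaceT.
  move=> tx; apply: cvgB; first apply: cvgM.
  - apply: (pc (fun tx => E tx.1)) => z; rewrite /continuous_at /E.
    apply: (@continuous_comp _ _ _ (fun z : R * R => - k * (z.1 - T)) expR);
      last exact: continuous_expR.
    by apply: cvgMl_tmp; apply: cvgB; [exact: cvg_fst|exact: cvg_cst].
  - by apply: cvgB; [exact: uc|exact: wc].
  apply: (pc (fun tx => delta * (barrier e tx.2 + 3 * (tx.1 - T)))) => z.
  apply: cvgMl_tmp; apply: cvgD; last first.
    by apply: cvgMl_tmp; apply: cvgB; [exact: cvg_fst|exact: cvg_cst].
  have c2 : y.2 @[y --> z] --> z.2 by exact: cvg_snd.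
  apply: cvgB; last exact: cvgMl_tmp.
  by apply: cvgD; [exact: cvg_cst|exact: (cvgM c2 c2)].
have ZB t (i : 'I_N) x : T <= t <= t1 -> B <= x -> Z t (inr i) x <= m.
  move=> /andP[Tt tt1] Bx; apply: le_trans m0.
  pose M := expR (`|k| * (t1 - T)).
  have M0 : 0 < M by exact: expR_gt0.
  have Md : 0 < M / delta by rewrite divr_gt0.
  have x_ge0 : 0 <= x by apply: le_trans Bx; exact: ltW.
  have xd : edge_dom (inr i : edge G) x by rewrite /= in_itv/= x_ge0.
  have EM : E t <= M.
    rewrite /E /M ler_expR (le_trans (ler_norm _))// normrM normrN.
    by rewrite ler_wpM2l// ger0_norm; lra.
  have {}EM : E t * (u t (inr i) x - w t (inr i) x) <= M.
    by apply: le_trans EM; rewrite ger_pMr//; exact: uw1.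
  have Mx : M <= delta * x by rewrite mulrC -ler_pdivrMr.
  have xb : x <= barrier (inr i) x + 3 * (t - T).
    by have := barrier_outer_ge i x; lra.
  have := ler_wpM2l (ltW d0) xb; rewrite /Z; lra.
have [t [e [x [tT xd mZ Zmax]]]] : exists t e x, [/\ T <= t <= t1, edge_dom e x,
    m < Z t e x & forall s e' y, T <= s <= t1 -> edge_dom e' y ->
    Z s e' y <= Z t e x].
  by apply: (graph_max Zc ZB); exists t0, e0, x0.
have {Zm t0 e0 x0 t0T x0d} Tt : T < t.
  rewrite lt_neqAle (andP tT).1 andbT; apply/eqP => tTE.
  have := uwT e x xd; move: mZ; rewrite /Z -tTE /E subrr mulr0 expR0 mul1r; lra.
(* q is the space derivative of Z. *)
pose q t e x := E t * (pu t e x - pw t e x) + - delta * (2 * x - edge_slope e).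
have barrierd e' (y : R) : is_derive y 1 (barrier e') (2 * y - edge_slope e').
  rewrite /barrier [X in is_derive _ _ X _](_ : _ =
    fun z : R => 1 * z ^+ 2 + (- edge_slope e') * z +
      (1 + \sum_(d : center_edge G) len d ^+ 2)); last by apply/funext => z; ring.
  by apply: is_derive_eq (is_derive_quadratic _ _ _ _) _; ring.
have qd s e' y : edge_dom e' y ->
    has_derive_in (edge_dom e') (Z s e') y (q s e' y).
  move=> yd.
  have c0 : has_derive_in (edge_dom e') (cst (3 * (s - T))) y 0.
    apply: has_derive_inW (@subsetT _ _) _; apply/is_deriveP; exact: is_derive_cst.
  have b0 : has_derive_in (edge_dom e') (barrier e') y (2 * y - edge_slope e').
    by apply: has_derive_inW (@subsetT _ _) _; exact/is_deriveP.
  have := has_derive_in_lin 1 (- delta)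
    (has_derive_in_lin (E s) (- E s) (pud s e' y yd) (pwd s e' y yd))
    (has_derive_in_lin 1 1 b0 c0).
  rewrite [X in has_derive_in _ X](_ : _ = Z s e'); last first.
    by apply/funext => z; rewrite /Z /=; ring.
  by rewrite [X in has_derive_in _ _ _ X](_ : _ = q s e' y) // /q; ring.
have [xi|[h [he hx]]] := edge_dom_cases xd.
  have [uD puD uE] := pueq t e x xi; have [wD pwD wE] := pweq t e x xi.
  have Dut := is_derive1_derivable uD; have Dwt := is_derive1_derivable wD.
  have Dux := is_derive1_derivable puD; have Dwx := is_derive1_derivable pwD.
  set ut := derive1 _ t in uE Dut; set wt := derive1 _ t in wE Dwt.
  set uxx := derive1 _ x in uE Dux; set wxx := derive1 _ x in wE Dwx.
  have Zt : 0 <= - k * E t * (u t e x - w t e x) + E t * (ut - wt) - 3 * delta.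
    apply: (max_derive_ge0 (g := fun s => Z s e x) Tt).
      by move=> s sT; apply: Zmax => //; lra.
    have Db := is_derive_quadratic 0 (3 * delta)
      (delta * (barrier e x - 3 * T)) t.
    have := is_deriveB (is_deriveM (is_derive_expR_linear (- k) T t)
      (is_deriveB Dut Dwt)) Db.
    rewrite [X in is_derive _ _ X](_ : _ = fun s => Z s e x); last first.
      apply/funext => s.
      change (E s * (u s e x - w s e x) - (0 * s ^+ 2 + 3 * delta * s +
        delta * (barrier e x - 3 * T)) = Z s e x).
      by rewrite /Z; ring.
    move=> D; apply: is_derive_eq D _.
    change (E t * (ut - wt) + (u t e x - w t e x) * (E t * - k) -
      (2 * 0 * t + 3 * delta) =
      - k * E t * (u t e x - w t e x) + E t * (ut - wt) - 3 * delta).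
    by ring.
  have Zxx : E t * (uxx - wxx) - 2 * delta <= 0.
    have [b [bx bi]] := edge_inner_nbhs xi.
    apply: (max_derive2_le0 (g := Z t e) (q := q t e) bx).
    - move=> y yb; have yi := bi y yb.
      apply: (@has_derive_in_interior _ (edge_dom e)); last exact: qd (edge_inner_dom yi).
      have [b' [by' bi']] := edge_inner_nbhs yi.
      have : nbhs y `]b'.1, b'.2[%classic by apply: near_in_itvoo; rewrite in_itv.
      by apply: filterS => z /=; rewrite in_itv/= => /bi'/edge_inner_dom.
    - by move=> y /bi/edge_inner_dom; exact: Zmax.
    have Db := is_derive_quadratic 0 (2 * delta) (- delta * edge_slope e) x.
    move: Dux Dwx Db => /is_deriveP Dux /is_deriveP Dwx /is_deriveP Db.
    have := has_derive_in_lin 1 (- 1)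
      (has_derive_in_lin (E t) (- E t) Dux Dwx) Db.
    rewrite [X in has_derive_in _ X](_ : _ = q t e); last first.
      by apply/funext => z; rewrite /q; ring.
    by move=> /is_deriveP D; apply: is_derive_eq D _; ring.
  have Df : f (u t e x) - f (w t e x) <= k * (u t e x - w t e x).
    apply: uwf => //; rewrite -(ltr_pM2l (E0 t)) mulrCA (mulrC (E t)) EN mulr1.
    have : m < Z t e x by []; rewrite /Z.
    have : 0 < delta * (t - T) by rewrite mulr_gt0// subr_gt0.
    lra.
  have := ler_wpM2l (ltW (E0 t)) Df; rewrite uE wE in Zt; lra.
(* At a vertex: Z takes the same value at all ends meeting there, so its inward
   derivatives are all nonpositive; their weighted sum is positive. *)
have nonpos (h' : (center_edge G * bool + 'I_N)%type) : end_vertex h' == end_vertex h ->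
    thickness (end_edge h') * (E t * (inward_derive (pu t) h' -
      inward_derive (pw t) h') + delta * edge_slope (end_edge h')) <= 0.
  move=> /eqP h'h; rewrite pmulr_rle0 ?thickness_gt0//.
  have ZE : Z t (end_edge h') (end_coord h') = Z t e x.
    by rewrite /Z -he -hx !barrier_end (uwd t _ _ h'h) (wwd t _ _ h'h).
  have := @inward_derive_max_le0 (Z t) (q t) h'.
  rewrite ZE => /(_ (fun y yd => Zmax t _ y tT yd) (qd t _ _ (edge_dom_end h'))).
  have -> : q t = fun e x => E t * (fun e x => 1 * pu t e x + -1 * pw t e x) e x
      + - delta * (fun e x => 2 * x - edge_slope e) e x.
    by apply/funext => e'; apply/funext => y; rewrite /q; ring.
  by rewrite !inward_derive_lin inward_derive_barrier; lra.
have sum0 : \sum_(h' : center_edge G * bool + 'I_N | end_vertex h' == end_vertex h)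
    thickness (end_edge h') * (E t * (inward_derive (pu t) h' -
      inward_derive (pw t) h') + delta * edge_slope (end_edge h')) <= 0.
  exact: sumr_le0.
suff : 0 < \sum_(h' : center_edge G * bool + 'I_N | end_vertex h' == end_vertex h)
    thickness (end_edge h') * (E t * (inward_derive (pu t) h' -
      inward_derive (pw t) h') + delta * edge_slope (end_edge h')).
  by rewrite ltNge sum0.
rewrite (eq_bigr (fun h' : (center_edge G * bool + 'I_N)%type =>
    E t * (thickness (end_edge h') * inward_derive (pu t) h')
    - E t * (thickness (end_edge h') * inward_derive (pw t) h')
    + delta * (thickness (end_edge h') * edge_slope (end_edge h')))); last first.
  by move=> h' _; ring.
rewrite big_split sumrB -!mulr_sumr/= puk pwk mulr0 subrr add0r.
rewrite pmulr_rgt0// (bigD1 (h : (center_edge G * bool + 'I_N)%type))//= ltr_pwDl//.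
  by rewrite mulr_gt0// ?thickness_gt0 ?edge_slope_gt0.
by apply: sumr_ge0 => h' _; rewrite mulr_ge0// ltW// ?thickness_gt0 ?edge_slope_gt0.
Qed.

(** * Lower bounds on segments and fronts at negative times *)

(** On an interval of half-length h around y, the gap [l - w] is at most 1 at
    time s and nonpositive on the lateral boundary, and it satisfies an
    inequality of heat type with source at most K.  It is dominated by
    A t * (2 h^2 - (x - y)^2), where the amplitude A decreases linearly in time
    from K + 1 + h^-2, large enough to dominate the initial gap, to K + 1, which
    suffices to beat the source. *)
Lemma ge_between f (w : R -> edge G -> R -> R) (i : 'I_N) (K l s y h : R) :
  entire_solution f w -> (forall t e x, edge_dom e x -> 0 < w t e x < 1) ->
  0 <= K -> (forall r, 0 < r < 1 -> - K <= f r) -> l <= 1 -> 0 < h < y ->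
  (forall t, s <= t <= s + 2 ->
    l <= w t (inr i) (y - h) /\ l <= w t (inr i) (y + h)) ->
  forall x, y - h <= x <= y + h -> l - 2 * h ^+ 2 * (K + 1) <= w (s + 2) (inr i) x.
Proof.
move=> [_ wc [p [pd _ peq _]]] w01 K0 fK l1 /andP[h0 hy] wl x0 x0h.
pose c := (h ^+ 2)^-1; have c0 : 0 < c by rewrite invr_gt0 exprn_gt0.
have ch : c * h ^+ 2 = 1 by rewrite mulVf// gt_eqF// exprn_gt0.
pose A t := K + 1 + (1 - (t - s) / 2) * c.
have A0 t : s <= t <= s + 2 -> K + 1 <= A t.
  by move=> ts; rewrite /A lerDl mulr_ge0// ?(ltW c0)//; lra.
pose F t x := l - w t (inr i) x - A t * (2 * h ^+ 2 - (x - y) ^+ 2).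
rewrite leNgt; apply/negP => lw.
have F0 : 0 < F (s + 2) x0.
  have -> : F (s + 2) x0 = l - w (s + 2) (inr i) x0 -
      (K + 1) * (2 * h ^+ 2 - (x0 - y) ^+ 2) by rewrite /F /A; field.
  have : 0 <= (K + 1) * (x0 - y) ^+ 2 by rewrite mulr_ge0 ?sqr_ge0//; lra.
  by move: lw; lra.
pose D : set (R * R) := `[s, s + 2]%classic `*` `[y - h, y + h]%classic.
have DE tx : D tx <-> s <= tx.1 <= s + 2 /\ y - h <= tx.2 <= y + h.
  by rewrite /D /= !in_itv.
have Ddom tx : D tx -> edge_dom (inr i : edge G) tx.2.
  by move=> /DE[_ ?]; rewrite /= in_itv/= andbT; lra.
have Dx0 : D (s + 2, x0) by apply/DE; split => //=; lra.
have Fc : {within D, continuous (fun tx => F tx.1 tx.2)}.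
  move=> tx; apply: cvgB.
    apply: cvgB; first exact: cvg_cst.
    by move: tx; apply: continuous_subspaceW (wc (inr i)) => tx; exact: Ddom.
  move: tx; apply: continuous_subspaceT => z.
  have c2 : tx.2 @[tx --> z] --> z.2 by exact: cvg_snd.
  have cy : (tx.2 - y) @[tx --> z] --> (z.2 - y).
    by apply: cvgB; [exact: c2|exact: cvg_cst].
  apply: cvgM; apply: cvgD; try exact: cvg_cst.
    apply: cvgMr_tmp; apply: cvgB; first exact: cvg_cst.
    by apply: cvgMr_tmp; apply: cvgB; [exact: cvg_fst|exact: cvg_cst].
  by apply: cvgN; exact: (cvgM cy cy).
have Dcpt : compact D by apply: compact_setX; exact: segment_compact.
have [[t x] /set_mem Dtx Fmax] :=
  compact_EVT_max (ex_intro _ _ Dx0) Dcpt Fc.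
have {F0} Ftx : 0 < F t x by apply: lt_le_trans (Fmax _ (mem_set Dx0)).
have {}Fmax r z : s <= r <= s + 2 -> y - h <= z <= y + h -> F r z <= F t x.
  by move=> rs zy; apply: (Fmax (r, z)); apply/mem_set/DE.
have /andP[w0 w1] := w01 t _ _ (Ddom _ Dtx).
have /DE[/= ts xy] := Dtx; have At := A0 _ ts.
have st : s < t.
  rewrite lt_neqAle (andP ts).1 andbT; apply/eqP => E; move: Ftx.
  move: w0; rewrite /F /A -E => w0.
  apply/negP; rewrite -leNgt subrr mul0r subr0 mul1r.
  have : h ^+ 2 <= 2 * h ^+ 2 - (x - y) ^+ 2 by nra.
  move=> /(ler_wpM2l (_ : 0 <= K + 1 + c)) H.
  have {}H := H ltac:(lra).
  have : 0 <= K * h ^+ 2 by rewrite mulr_ge0// sqr_ge0.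
  have : 0 <= h ^+ 2 by rewrite sqr_ge0.
  by move: H; rewrite !mulrDl ch mul1r; lra.
have xh : y - h < x < y + h.
  have W z : z = - h \/ z = h -> x = y + z -> l <= w t (inr i) x -> False.
    move=> zh xE; move: Ftx; rewrite xE => + lwx; apply/negP; rewrite -leNgt /F.
    have : 0 <= A t * (2 * h ^+ 2 - (y + z - y) ^+ 2).
      rewrite mulr_ge0//; first by lra.
      rewrite (addrC y) addrK; have := sqr_ge0 h.
      by case: zh => ->; rewrite ?sqrrN; lra.
    lra.
  rewrite !lt_neqAle (andP xy).1 (andP xy).2 !andbT.
  have [wl1 wl2] := wl t ts.
  apply/andP; split; apply/eqP => E.
    by apply: (W (- h)); [left| |rewrite -E].
  by apply: (W h); [right| |rewrite E].
have xi z : y - h < z < y + h -> edge_inner (inr i : edge G) z.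
  by move=> zy; rewrite /= in_itv/= andbT; lra.
have [wD pD wE] := peq t _ _ (xi x xh).
have Dwt := is_derive1_derivable wD; have Dwx := is_derive1_derivable pD.
set wt := derive1 _ t in wE Dwt; set wxx := derive1 _ x in wE Dwx.
have Ft : 0 <= - wt + c / 2 * (2 * h ^+ 2 - (x - y) ^+ 2).
  apply: (max_derive_ge0 (g := fun r => F r x) st).
    by move=> r rs; apply: Fmax => //; lra.
  move: (Dwt) => /is_deriveP Dw.
  have /is_deriveP Db := is_derive_quadratic 0
    (c / 2 * (2 * h ^+ 2 - (x - y) ^+ 2))
    (l - (K + 1 + c + s / 2 * c) * (2 * h ^+ 2 - (x - y) ^+ 2)) t.
  have := has_derive_in_lin (- 1) 1 Dw Db.
  rewrite [X in has_derive_in _ X](_ : _ = fun r => F r x); last first.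
    by apply/funext => z; rewrite /F /A; field.
  by move=> /is_deriveP Dt; apply: is_derive_eq Dt _; ring.
have Fxx : - wxx + 2 * A t <= 0.
  apply: (max_derive2_le0 (g := F t)
    (q := fun z => -1 * p t (inr i) z + 1 * (2 * A t * z - 2 * A t * y)) xh).
  - move=> z zy; apply/is_deriveP.
    have /(has_derive_in_interior _) : has_derive_in _ _ _ _ :=
      pd t _ z (edge_inner_dom (xi z zy)).
    have zn : nbhs z (edge_dom (inr i : edge G)).
      have : nbhs z `]y - h, y + h[%classic by apply: near_in_itvoo; rewrite in_itv.
      by apply: filterS => z' /=; rewrite in_itv/= => /xi/edge_inner_dom.
    move=> /(_ zn)/is_deriveP Dw.
    have /is_deriveP Db := is_derive_quadratic (A t) (- (2 * A t * y))
      (l - A t * (2 * h ^+ 2 - y ^+ 2)) z.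
    have := has_derive_in_lin (- 1) 1 Dw Db.
    congr (has_derive_in _ _ _ _).
    by apply/funext => z'; rewrite /F; ring.
  - by move=> z zy; apply: Fmax => //; lra.
  move: (Dwx) => /is_deriveP Dw.
  have /is_deriveP Db := is_derive_quadratic 0 (2 * A t) (- (2 * A t * y)) x.
  have := has_derive_in_lin (- 1) 1 Dw Db.
  rewrite [X in has_derive_in _ X](_ : _ = fun z => 
     -1 * p t (inr i) z + 1 * (2 * A t * z - 2 * A t * y)); last first.
    by apply/funext => z; ring.
  by move=> /is_deriveP Dt; apply: is_derive_eq Dt _; ring.
have fw : - K <= f (w t (inr i) x) by apply: fK; rewrite w0.
have : c / 2 * (2 * h ^+ 2 - (x - y) ^+ 2) <= 1.
  have : 0 <= c * (x - y) ^+ 2 by rewrite mulr_ge0 ?sqr_ge0// ltW.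
  by lra.
by move: Ft Fxx; rewrite wE; lra.
Qed.

(** The term of the front distance on Omega_j compares [u] with the wave, whose
    value phi (- x - c t) at x <= X becomes small as t tends to -oo, since
    - X - c t then tends to +oo; the other term controls the rest of the
    graph.  The second outer path m makes the supremum over that rest
    nonnegative, as it would be -oo over the empty set. *)
Lemma front_small f (phi : R -> R) (c : R) (j m : 'I_N) (u : R -> edge G -> R -> R)
    (e0 X : R) :
  0 < c -> phi z @[z --> +oo] --> (0 : R) -> m != j ->
  front_like f phi c j u -> 0 < e0 -> 0 <= X ->
  exists T0, forall t e x, t <= T0 -> edge_dom e x ->
    u t e x <= e0 \/ e = inr j /\ X < x.
Proof.
move=> c0 phi0 mj [[wd _ _] u01 ud] e00 X0.
have e20 : 0 < e0 / 2 by rewrite divr_gt0.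
have [T1 [_ T1P]] : \forall t \near -oo, (front_distance phi c j u t < (e0 / 2)%:E)%E.
  apply: (ud (fun y => y < (e0 / 2)%:E)%E).
  by apply: open_ereal_lt'; rewrite lte_fin.
have [Z [_ ZP]] : \forall z \near +oo, phi z < e0 / 2.
  by apply: (cvgr_lt (0 : R)) => //.
pose T2 := - (Z + X + 1) / c.
exists (Num.min (T1 - 1) T2) => t e x; rewrite le_min => /andP[tT1 tT2] xd.
have {T1P} := T1P t ltac:(lra); rewrite /front_distance.
set S1 := ereal_sup _; set S2 := ereal_sup _ => S12.
have jd (y : R) : 0 <= y -> edge_dom (inr j : edge G) y.
  by move=> y0; rewrite /= in_itv/= y0.
have S1ub y : 0 <= y -> (`|u t (inr j) y - phi (- y - c * t)|%:E <= S1)%E.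
  by move=> y0; apply: ereal_sup_ubound; exists y; rewrite //=; exact: jd.
have S2ub e' y : edge_dom e' y -> ~ on_outer_path j e' y -> (`|u t e' y|%:E <= S2)%E.
  by move=> yd yj; apply: ereal_sup_ubound; exists e', y.
have S10 : (0 <= S1)%E by apply: le_trans (S1ub 0 (lexx _)); rewrite lee_fin.
have S20 : (0 <= S2)%E.
  have m1 : edge_dom (inr m : edge G) 1 by rewrite /= in_itv/= ler01.
  apply: le_trans (S2ub (inr m) 1 m1 _); first by rewrite lee_fin.
  case=> [[/eqP]|[h [hm h1 _]]]; first by rewrite (negbTE mj).
  by case: h hm h1 => [[d b]|i'] //= _ /eqP; rewrite eq_sym oner_eq0.
have onj y : 0 <= y -> u t (inr j) y <= e0 \/ X < y.
  move=> y0; have [yX|] := leP y X; [left|by right].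
  have ph : phi (- y - c * t) < e0 / 2.
    apply: ZP; move: tT2; rewrite /T2 ler_pdivlMr// mulrC; lra.
  have : (`|u t (inr j) y - phi (- y - c * t)|%:E < (e0 / 2)%:E)%E.
    by apply: le_lt_trans S12; apply: le_trans (S1ub y y0) _; exact: leeDl.
  by rewrite lte_fin ltr_norml => /andP[_]; lra.
have [[ej|[h [<- <- hj]]]|nj] := pselect (on_outer_path j e x).
- subst e; have [|?|?] := onj x; last by right.
    by move: xd; rewrite /= in_itv/= andbT.
  by left.
- rewrite (wd t h (inr j) hj) /=; left.
  by have [//|] := onj 0 (lexx _); rewrite ltNge X0.
left; apply: le_trans (ler_norm _) _; rewrite -lee_fin.
apply: le_trans (S2ub _ _ xd nj) _.
apply: le_trans (_ : S1 + S2 <= _)%E; first exact: leeDr.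
by rewrite ltW// (lt_le_trans S12)// lee_fin; lra.
Qed.

(** Pointwise eventual lower bounds at the nodes of a fine subdivision propagate
    to the cells of the subdivision at the cost of [eta]. *)
Lemma eventually_ge_on_segment f (w : R -> edge G -> R -> R) (i : 'I_N)
    (K l eta X L : R) :
  entire_solution f w -> (forall t e x, edge_dom e x -> 0 < w t e x < 1) ->
  0 <= K -> (forall r, 0 < r < 1 -> - K <= f r) -> l <= 1 -> 0 < eta -> 0 < X ->
  (forall x, X <= x -> \forall t \near +oo, l <= w t (inr i) x) ->
  exists S, forall t x, S <= t -> X <= x <= L -> l - eta <= w t (inr i) x.
Proof.
move=> ws w01 K0 fK l1 eta0 X0 wl.
pose h := Num.min 1 (eta / (2 * (K + 1))).
have [h0 h1 heta] : [/\ 0 < h, h <= 1 & 2 * h ^+ 2 * (K + 1) <= eta].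
  have K1 : 0 < 2 * (K + 1) by lra.
  have h0 : 0 < h by rewrite lt_min ltr01 divr_gt0.
  have h1 : h <= 1 by rewrite ge_min lexx.
  have : h * (2 * (K + 1)) <= eta by rewrite -ler_pdivlMr// ge_min lexx orbT.
  have : h ^+ 2 * (K + 1) <= h * (K + 1).
    by rewrite ler_wpM2r//; [lra|rewrite expr2 ger_pMr].
  by split => //; lra.
suff H n : exists S, forall t x, S <= t -> X <= x <= X + 2 * h * n%:R ->
    l - eta <= w t (inr i) x.
  have [n Ln] : exists n, L <= X + 2 * h * n%:R.
    have h20 : 0 < 2 * h by rewrite mulr_gt0.
    exists (Num.bound `|(L - X) / (2 * h)|); rewrite -lerBlDl.
    rewrite mulrC -ler_pdivrMr// (le_trans (ler_norm _))//.
    by rewrite ltW// archi_boundP.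
  have [S SP] := H n; exists S => t x St /andP[Xx xL].
  by apply: SP; rewrite // Xx (le_trans xL).
elim: n => [|n [S SP]].
  have [S [_ SP]] := wl X (lexx _); exists (S + 1) => t x St.
  rewrite mulr0 addr0 -eq_le => /eqP <-.
  by have := SP t ltac:(lra); lra.
have hn : 0 <= 2 * h * n%:R by rewrite !mulr_ge0// ltW.
pose y := X + 2 * h * n%:R + h.
have [S1 [_ S1P]] := wl (y - h) ltac:(rewrite /y; lra).
have [S2 [_ S2P]] := wl (y + h) ltac:(rewrite /y; lra).
exists (Num.max S (Num.max S1 S2) + 3) => t x; rewrite -lerBrDr !ge_max.
move=> /and3P[St S1t S2t] /andP[Xx xn].
have [xy|yx] := leP x (X + 2 * h * n%:R); first by apply: SP; lra.
have -> : t = t - 2 + 2 by ring.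
apply: (@le_trans _ _ (l - 2 * h ^+ 2 * (K + 1))); first by lra.
apply: (ge_between ws w01 K0 fK l1 (y := y)).
- by rewrite h0 /y; lra.
- by move=> r rt; split; [apply: S1P|apply: S2P]; lra.
- by move: xn; rewrite -natr1 /y; lra.
Qed.

(** * The front from Omega_j stays below the limit profile *)

(** The comparison runs in two phases.  On [T, T1] the excess of [u] over the
    shifted solution contracts at rate b, from at most 1 to about exp(- b d); on
    [T1, t0] it is multiplied by at most exp(K (t0 - T1)).  The length d = T1 - T
    of the first phase is chosen to make the product small, then the weight
    delta of the barrier, then the length L of the piece of Omega_j on which the
    shifted solution must be close to 1, and finally the shift s. *)
Lemma front_le_limit f (a : R) (phi : R -> R) (c : R) (j m : 'I_N)
    (u w : R -> edge G -> R -> R) (v : edge G -> R -> R) :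
  bistable f a -> 0 < c -> phi z @[z --> +oo] --> (0 : R) -> m != j ->
  front_like f phi c j u ->
  entire_solution f w -> (forall t e x, edge_dom e x -> 0 < w t e x < 1) ->
  limit_profile w v -> v (inr j) x @[x --> +oo] --> (1 : R) ->
  forall t e x, edge_dom e x -> u t e x <= v e x.
Proof.
move=> bf c0 phi0 mj uf ws w01 wv vj t0 e0 x0 x0d.
have [us u01 _] := uf.
have [df cf] := (bistable_derivable bf, bistable_continuous_derive bf).
have [K K0 fK] := lipschitz_on01 df cf.
have [b [eps [b0 eps0 eps1 fb]]] := bistable_dissipative bf.
have fK' r : 0 < r < 1 -> - K <= f r.
  move=> /andP[r0 r1]; have := fK r 1 (ltW r0) (ltW r1) (lexx _).
  rewrite (bistable_1 bf).
  have : K * (1 - r) <= K * 1 by rewrite ler_wpM2l//; lra.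
  lra.
have [X X0 wl] : exists2 X, 0 < X &
    forall x, X <= x -> \forall t \near +oo, 1 - eps / 2 <= w t (inr j) x.
  have [X [_ XP]] : \forall x \near +oo, 1 - eps / 2 < v (inr j) x.
    by apply: (cvgr_gt (1 : R)) => //; lra.
  exists (Num.max X 0 + 1) => [|x]; first by rewrite ltr_pwDr// le_max lexx orbT.
  rewrite -lerBrDr ge_max => /andP[Xx x1].
  have xd : edge_dom (inr j : edge G) x by rewrite /= in_itv/= andbT; lra.
  by apply: (cvgr_ge (v (inr j) x)); [exact: wv|apply: XP; lra].
have [T0 T0P] := front_small c0 phi0 mj uf eps0 (ltW X0).
have [T1 T10 T1t] : exists2 T1, T1 <= T0 & T1 <= t0.
  by exists (Num.min T0 t0); rewrite ge_min lexx ?orbT.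
apply/ler_addgt0Pr => eta eta0.
have [M ME] : exists M, M = expR (K * (t0 - T1)) by eexists.
have M0 : 0 < M by rewrite ME expR_gt0.
(* The length of the first phase comes from expR x >= 1 + x. *)
have [d d0 MEd] : exists2 d, 0 < d & M * expR (- b * d) <= eta / 2.
  exists (2 * M / (eta * b)); first by rewrite divr_gt0 ?mulr_gt0.
  set bd := - b * _; have {bd}-> : bd = - (2 * M / eta).
    by rewrite /bd; field; rewrite !gt_eqF.
  have : 2 * M / eta <= expR (2 * M / eta).
    by rewrite (le_trans _ (expR_ge1Dx _))// lerDr.
  rewrite ler_pdivrMr// expRN ler_pdivrMr ?expR_gt0// => Md.
  by rewrite mulrAC ler_pdivlMr// mulrC [eta * _]mulrC.
have [E EE] : exists E, E = expR (- b * d) by eexists.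
have E0 : 0 < E by rewrite EE expR_gt0.
rewrite -EE in MEd.
pose C := barrier e0 x0 + 3 * (d + (t0 - T1)).
have C0 : 0 <= C by have := barrier_ge0 x0d; rewrite /C; lra.
have [delta delta0 deltaC] : exists2 delta, 0 < delta & delta * C <= 1.
  by exists (1 + C)^-1; rewrite ?invr_gt0 1?mulrC ?ler_pdivrMr; lra.
(* Past L the barrier alone exceeds 1 during the whole first phase. *)
have [L L0 LE] : exists2 L, 0 < L & delta * L * E = 1.
  exists (delta * E)^-1; first by rewrite invr_gt0 mulr_gt0.
  by rewrite mulrAC divff// gt_eqF// mulr_gt0.
pose T := T1 - d.
have [S SP] := eventually_ge_on_segment L ws w01 K0 fK' (ltac:(lra) : 1 - eps / 2 <= 1)
  (divr_gt0 eps0 (ltr0n _ 2)) X0 wl.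
have key s : S - T <= s -> u t0 e0 x0 - w (t0 + s) e0 x0 <= eta.
  move=> Ss; have ws' := entire_solution_shift s ws.
  have uw1 t e x : edge_dom e x -> u t e x - w (t + s) e x <= 1.
    by move=> xd; have := u01 t e x xd; have := w01 (t + s) e x xd; lra.
  have phase1 e x (xd : edge_dom e x) : u T1 e x - w (T1 + s) e x <=
      E * (1 + delta * (barrier e x + 3 * d)).
    have -> : d = T1 - T by rewrite /T; ring.
    have {}EE : E = expR (- b * (T1 - T)) by rewrite EE /T opprB addrCA subrr addr0.
    have TT : T <= T1 <= T1 by rewrite /T; lra.
    rewrite EE; apply: (comparison us ws' uw1 delta0 ler01 _ _ TT xd).
      move=> e' x' xd'; apply: le_trans (uw1 _ _ _ xd') _.
      rewrite lerDl; apply: mulr_ge0; first exact: (ltW delta0).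
      exact: barrier_ge0 xd'.
    move=> t e' x' tT xi uw; have {}xd := edge_inner_dom xi.
    have uw0 : 0 < u t e' x' - w (t + s) e' x'.
      apply: le_lt_trans uw; apply: mulr_ge0; last exact: expR_ge0.
      by apply: mulr_ge0; [exact: (ltW delta0)|exact: barrier_ge0].
    have /andP[w0 w1] := w01 (t + s) _ _ xd; have /andP[u0 u1] := u01 t _ _ xd.
    apply: fb => //; first by lra.
    have [|ue|[e'j Xx]] := T0P t e' x' _ xd; first by lra.
      by left.
    right; subst e'.
    have -> : 1 - eps = 1 - eps / 2 - eps / 2 by lra.
    apply: SP; first by move: tT; lra.
    rewrite (ltW Xx) leNgt; apply/negP => Lx.
    have : delta * L * E <= delta * barrier (inr j) x' * expR (- b * (t - T)).
      apply: ler_pM; [|exact: ltW| |].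
      - by apply: mulr_ge0; exact: ltW.
      - rewrite ler_wpM2l ?(ltW delta0)// (le_trans (ltW Lx))//.
        exact: barrier_outer_ge.
      rewrite EE ler_expR !mulNr lerN2 ler_wpM2l ?(ltW b0)//.
      by move: tT; rewrite /T; lra.
    by rewrite LE; lra.
  have m0 : 0 <= E * (1 + delta * (3 * d)).
    by rewrite mulr_ge0 ?addr_ge0 ?mulr_ge0// ltW.
  have phase2 : u t0 e0 x0 - w (t0 + s) e0 x0 <= M * (E * (1 + delta * (3 * d)) +
      E * delta * (barrier e0 x0 + 3 * (t0 - T1))).
    have tt : T1 <= t0 <= t0 by lra.
    rewrite ME; apply: (comparison us ws' uw1 (mulr_gt0 E0 delta0) m0 _ _ tt x0d).
    - by move=> e x /phase1; lra.
    - move=> t e x tT xi uw; have xd := edge_inner_dom xi.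
      have uw0 : 0 < u t e x - w (t + s) e x.
        apply: le_lt_trans uw; apply: mulr_ge0; last exact: expR_ge0.
        apply: mulr_ge0; last exact: barrier_ge0.
        exact: (ltW (mulr_gt0 E0 delta0)).
      by have := u01 t e x xd; have := w01 (t + s) e x xd; move=> *; apply: fK; lra.
  apply: le_trans phase2 _.
  have -> : M * (E * (1 + delta * (3 * d)) + E * delta * (barrier e0 x0 + 3 * (t0 - T1)))
    = M * E * (1 + delta * C) by rewrite /C; ring.
  have ME0 : 0 <= M * E by rewrite mulr_ge0 ?ltW.
  have : M * E * (1 + delta * C) <= M * E * 2 by rewrite ler_wpM2l//; lra.
  lra.
rewrite -lerBlDr; apply: (cvgr_to_ge (wv e0 x0 x0d)).
exists (S - T + t0); split; first exact: num_real.
move=> t tS; have := key (t - t0) ltac:(lra).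
by rewrite [t0 + _]addrC subrK; lra.
Qed.

End OuterPathGraph.

Theorem theorem2p5 (R : realType) (N : nat) (hN : (2 <= N)%N)
    (G : outer_path_graph R N) (f : R -> R) (a : R) (hf : bistable f a)
    (phi : R -> R) (c : R) (hphi : traveling_wave f a phi c)
    (i j k : 'I_N) (hij : i != j) (hjk : j != k) (hik : i != k) :
  propagation_index G f phi c i j = 1%N ->
  propagation_index G f phi c j k = 1%N ->
  propagation_index G f phi c i k = 1%N.
Proof.
have indexP p q : propagation_index G f phi c p q = 1%N <->
    propagates G f phi c p q.
  by rewrite /propagation_index; case: asboolP => ?; split.
rewrite !indexP => -[ui [vi [uif uiv vij]]] [uj [vj [ujf ujv vjk]]].
exists ui, vi; split => //.
have [uis ui01 _] := uif.
have uj_vi := front_le_limit hf (wave_speed_gt0 hphi) (wave_pinfty hphi) hij ujf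
  uis ui01 uiv vij.
have kd (x : R) : 0 <= x -> edge_dom (inr k : edge G) x.
  by move=> x0; rewrite /= in_itv/= x0.
apply: (squeeze_cvgr _ vjk (@cvg_cst _ (1 : R) _ _ _)).
near=> x; have xd : edge_dom (inr k : edge G) x by exact: kd.
apply/andP; split; [apply: (cvgr_to_le (ujv _ _ xd))|apply: (cvgr_to_le (uiv _ _ xd))];
  apply: nearW => t; first exact: uj_vi.
by have /andP[_ /ltW] := ui01 t _ _ xd.
Unshelve. all: by end_near. Qed.
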